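(* Fix $\gamma\in(0,1)$ and set $\alpha^{\oplus}=\sqrt{\frac{1+\sqrt{1-\gamma}}{2\pi^2}}$, $\alpha^{\ominus}=\sqrt{\frac{1-\sqrt{1-\gamma}}{2\pi^2}}$. For $\varepsilon>0$ let $\Lambda=\{k\in\mathbb{N}:\lceil\alpha^{\ominus}/\varepsilon\rceil\le k\le\lfloor\alpha^{\oplus}/\varepsilon\rfloor\}$, let $(c_k)_{k\in\Lambda}$ be independent standard normal random variables, and define $f(x)=\sum_{k\in\Lambda}c_k\sqrt{2}\cos(k\pi x)$ for $x\in[0,1]$. Then for any choice of $\delta>0$ and any $q>1$ there exists a constant $C>0$, independent of $\varepsilon$, such that $$\mathbb{P}\Big(\|f\|_{L^\infty(0,1)}\le\varepsilon^{-\delta}\|f\|_{L^2(0,1)}\Big)\ge1-C\varepsilon^q .$$ *)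

(* Defs.v *)
From HB Require Import structures.
From mathcomp Require Import all_boot all_order all_algebra.
From mathcomp Require Import all_classical all_reals all_analysis.
Set Implicit Arguments. Unset Strict Implicit. Unset Printing Implicit Defensive.
Import Order.TTheory GRing.Theory Num.Theory.
Local Open Scope classical_set_scope.
Local Open Scope ring_scope.

Definition alpha_plus {R : realType} (g : R) : R :=
  Num.sqrt ((1 + Num.sqrt (1 - g)) / (2 * pi ^+ 2)).
Definition alpha_minus {R : realType} (g : R) : R :=
  Num.sqrt ((1 - Num.sqrt (1 - g)) / (2 * pi ^+ 2)).

Definition Lambda {R : realType} (g e : R) : seq nat :=
  [seq k <- iota 0 (`|Num.floor (alpha_plus g / e)|%N).+1 |
     (Num.ceil (alpha_minus g / e) <= k%:Z) && (k%:Z <= Num.floor (alpha_plus g / e))].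

Definition rand_f {R : realType} {T : Type} (g e : R) (c : nat -> T -> R)
  (w : T) (x : R) : R :=
  \sum_(k <- Lambda g e) c k w * Num.sqrt 2 * cos (k%:R * pi * x).

Definition mes01 {R : realType} : measurable (`[0%R, 1%R] : set R) :=
  measurable_itv `[0%R, 1%R].
Definition leb01 {R : realType} := mrestr (@lebesgue_measure R) (@mes01 R).

Definition std_normal {d} {T : measurableType d} {R : realType}
  (P : probability T R) (X : T -> R) : Prop :=
  measurable_fun setT X /\
  forall B : set R, measurable B -> P (X @^-1` B) = normal_prob 0 1 B.

Definition mutually_independent {d} {T : measurableType d} {R : realType}
  (P : probability T R) (I : seq nat) (X : nat -> T -> R) : Prop :=
  forall (J : seq nat) (B : nat -> set R),
    {subset J <= I} -> uniq J -> (forall j, j \in J -> measurable (B j)) ->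
    P (\bigcap_(j in [set j | j \in J]) (X j @^-1` B j)) =
    (\prod_(j <- J) P (X j @^-1` B j))%E.

(* Main.v *)
(** Each [c k] is symmetric, so the law of the coefficient vector is invariant
    under all sign changes [c k -> s k * c k].  Averaging over the signs bounds
    the probability of the bad event by the largest proportion, over fixed
    coefficients [y], of sign patterns [s] for which
    [sup |f_(s y)| > eps^-delta * |y|_2].  The random signs make [f_(s y) x]
    subgaussian with variance at most [2 |y|_2^2], so a single point [x] fails
    with proportion at most [2 exp (- u^2 / 16)] at level [u |y|_2].  Since all
    frequencies and their number are [O(1/eps)], [f_(s y)] is Lipschitz with
    constant [O(eps^-2) |y|_2], and a union bound over a grid of [O(eps^-2)]
    points costs only a power of [eps], which the factor
    [exp (- eps^(-2 delta) / 64)] absorbs. *)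

Require Import Defs.
From HB Require Import structures.
From mathcomp Require Import all_boot all_order all_algebra.
From mathcomp Require Import all_classical all_reals all_analysis.
From mathcomp Require Import measurable_realfun ess_sup_inf ring lra.
Import Order.TTheory GRing.Theory Num.Theory.
Import numFieldNormedType.Exports.
Local Open Scope classical_set_scope.
Local Open Scope ring_scope.

(** * Subgaussian tails of sign sums, in counting form *)

(** A weak form of [cosh x <= exp (x^2 / 2)] with an elementary proof. If [x^2 > 1/4] then
    [|x| <= 2 x^2] bounds each exponential; otherwise [exp y <= 1 / (1 - y)] gives the sum
    [2 / (1 - x^2)], which is at most [2 (1 + 2 x^2)]. *)
Lemma coshR_le (R : realType) (x : R) :
  expR x + expR (- x) <= 2 * expR (2 * x ^+ 2).
Proof.
have [x2|x2] := leP (x ^+ 2) 4^-1; last first.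
  have h (y : R) : y ^+ 2 = x ^+ 2 -> expR y <= expR (2 * x ^+ 2).
    move=> yx; rewrite ler_expR -yx; rewrite -yx in x2.
    by have [y0|y0] := leP y 0; nra.
  by rewrite mulrDl mul1r lerD// h// sqrrN.
have inv (y : R) : y < 1 -> expR y <= (1 - y)^-1.
  move=> y1; rewrite -[y in leLHS]opprK expRN lef_pV2 ?posrE ?expR_gt0 ?subr_gt0//.
  exact: expR_ge1Dx.
have x1 : x < 1 by nra.
have Nx1 : - x < 1 by nra.
apply: (le_trans (lerD (inv _ x1) (inv _ Nx1))).
have -> : (1 - x)^-1 + (1 - - x)^-1 = 2 * (1 - x ^+ 2)^-1.
  by field; rewrite !lt0r_neq0//; nra.
rewrite ler_pM2l//; apply: (@le_trans _ _ (1 + 2 * x ^+ 2)); last exact: expR_ge1Dx.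
have x20 := sqr_ge0 x.
rewrite -[leLHS]mul1r ler_pdivrMr; last by lra.
by nra.
Qed.

(** Independence of the signs in counting form: the sum over patterns of a product is the product of
    the two-term sums, each of which is bounded by [coshR_le]. *)
Lemma sum_sign_expR (R : realType) (I : finType) (b : I -> R) (t : R) :
  \sum_(s : {ffun I -> bool}) expR (t * \sum_i (-1) ^+ s i * b i) <=
  2 ^+ #|I| * expR (2 * t ^+ 2 * \sum_i b i ^+ 2).
Proof.
under eq_bigr => s _ do rewrite mulr_sumr expR_sum.
rewrite -(bigA_distr_bigA (fun i (j : bool) => expR (t * ((-1) ^+ j * b i)))) /=.
rewrite mulr_sumr expR_sum -prodr_const -big_split/=.
apply: ler_prod => i _; rewrite big_bool/= addr_ge0 ?expR_ge0//=.
rewrite expr0 expr1 mul1r mulN1r mulrN addrC -mulrA -exprMn.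
exact: coshR_le.
Qed.

(** Chernoff's method: Markov's inequality for the exponential moment. The 2 in the variance bound
    anticipates the squared normalisation [Num.sqrt 2] of the cosines. *)
Lemma card_sign_gt (R : realType) (I : finType) (b : I -> R) (u B : R) :
  0 <= u -> 0 <= B -> \sum_i b i ^+ 2 <= 2 * B ^+ 2 ->
  #|[pred s : {ffun I -> bool} | u * B < \sum_i (-1) ^+ s i * b i]|%:R <=
  2 ^+ #|I| * expR (- (u ^+ 2 / 16)).
Proof.
move=> u0 B0 bB.
(* For [B = 0] all [b i] vanish, and the strict inequality makes the counted set empty. *)
have [B00|B1] := eqVneq B 0.
  have b0 i : b i = 0.
    apply/eqP; rewrite -sqrf_eq0 eq_le sqr_ge0 andbT.
    apply: le_trans (_ : _ <= \sum_i b i ^+ 2) _.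
      by rewrite (bigD1 i)//= lerDl sumr_ge0// => j _; exact: sqr_ge0.
    by rewrite (le_trans bB)// B00 expr0n/= mulr0.
  rewrite eq_card0 ?mulr_ge0 ?exprn_ge0 ?expR_ge0// => s.
  rewrite !inE B00 mulr0 big1 ?ltxx// => i _.
  by rewrite b0 mulr0.
have {}B1 : 0 < B by rewrite lt_neqAle eq_sym B1.
(* This [t] minimises the exponent [4 t^2 B^2 - t u B]; the minimum is [- u^2 / 16]. *)
pose t := u / (8 * B).
have t0 : 0 <= t by rewrite divr_ge0// mulr_ge0.
have markov : #|[pred s : {ffun I -> bool} |
      u * B < \sum_i (-1) ^+ s i * b i]|%:R * expR (t * (u * B)) <=
    \sum_(s : {ffun I -> bool}) expR (t * \sum_i (-1) ^+ s i * b i).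
  rewrite mulr_natl -sumr_const big_mkcond/=; apply: ler_sum => s _.
  case: ifPn => [|_]; last exact: expR_ge0.
  by rewrite inE ler_expR => /ltW; exact: ler_wpM2l.
have := le_trans markov (sum_sign_expR R I b t).
rewrite -ler_pdivlMr ?expR_gt0// => /le_trans; apply.
rewrite -[leLHS]mulrA ler_wpM2l ?exprn_ge0// -expRN -expRD ler_expR.
apply: (@le_trans _ _ (2 * t ^+ 2 * (2 * B ^+ 2) - t * (u * B))).
  by rewrite lerD2r ler_wpM2l// mulr_ge0// sqr_ge0.
rewrite le_eqVlt; apply/orP; left; apply/eqP; rewrite /t; field.
by rewrite gt_eqF.
Qed.

Lemma card_sign_normr_gt (R : realType) (I : finType) (b : I -> R) (u B : R) :
  0 <= u -> 0 <= B -> \sum_i b i ^+ 2 <= 2 * B ^+ 2 ->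
  #|[pred s : {ffun I -> bool} | u * B < `|\sum_i (-1) ^+ s i * b i|]|%:R <=
  2 ^+ #|I| * (2 * expR (- (u ^+ 2 / 16))).
Proof.
move=> u0 B0 bB.
have bN : \sum_i (- b i) ^+ 2 <= 2 * B ^+ 2.
  by under eq_bigr do rewrite sqrrN.
have := lerD (card_sign_gt _ _ _ _ _ u0 B0 bB) (card_sign_gt _ _ _ _ _ u0 B0 bN).
rewrite -mulr2n -[leRHS]mulr_natl mulrCA => h.
apply: le_trans h => {bB bN}.
rewrite -natrD ler_nat -cardUI; apply: leq_trans (leq_addr _ _).
apply/subset_leq_card/fintype.subsetP => s; rewrite !inE lter_normr -sumrN.
by under [X in _ || (_ < X) -> _]eq_bigr do rewrite -mulrN.
Qed.

(** * Derivatives and primitives of cosines *)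

Lemma is_derive_sumr (R : realType) (I : Type) (s : seq I)
    (h : I -> R -> R) (dh : I -> R) (x : R) :
  (forall i, is_derive x 1 (h i) (dh i)) ->
  is_derive x 1 (fun y => \sum_(i <- s) h i y) (\sum_(i <- s) dh i).
Proof.
move=> hdh; elim: s => [|i s ih].
  rewrite big_nil (_ : (fun _ => _) = cst 0); last first.
    by apply/funext => y; rewrite big_nil.
  exact: is_derive_cst.
rewrite big_cons (_ : (fun _ => _) = h i \+ fun y => \sum_(j <- s) h j y).
  exact: is_deriveD.
by apply/funext => y; rewrite big_cons.
Qed.

Lemma is_derive1_scale (R : realType) (f : R -> R) (a x df : R) :
  is_derive (a * x) 1 f df -> is_derive x 1 (fun y => f (a * y)) (a * df).
Proof.
move=> fdf; rewrite mulrC.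
apply: (@is_derive1_comp _ f ( *%R a)) => //.
have := is_deriveZ a (is_derive_id x 1 : is_derive x 1 (@id R) 1).
by rewrite /GRing.scale /= mulr1.
Qed.

Lemma sin_natmulpi (R : realType) (n : nat) : sin (n%:R * pi) = 0 :> R.
Proof.
elim: n => [|n ih]; first by rewrite mul0r sin0.
by rewrite -natr1 mulrDl mul1r sinDpi ih oppr0.
Qed.

(** The primitive of [cos (m pi x)] vanishing at 0. The case [m = 0] is apart because the quotient
    would then be 0 by convention instead of [x]. *)
Definition cosint {R : realType} (m x : R) : R :=
  if m == 0 then x else sin (m * pi * x) / (m * pi).

Lemma is_derive_cosint (R : realType) (m x : R) :
  is_derive x 1 (cosint m) (cos (m * pi * x)).
Proof.
rewrite /cosint; have [->|m0] := eqVneq m 0.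
  by rewrite !mul0r cos0; exact: is_derive_id.
have mpi : m * pi != 0 by rewrite mulf_neq0// gt_eqF// pi_gt0.
rewrite (_ : (fun _ => _) = (m * pi)^-1 \*: (fun y => sin (m * pi * y))).
  have := is_deriveZ (m * pi)^-1
    (is_derive1_scale _ _ _ _ _ (is_derive_sin (m * pi * x))).
  by rewrite /GRing.scale/= mulKf.
by apply/funext => y; rewrite /= /GRing.scale/= mulrC.
Qed.

Lemma cosint0 (R : realType) (m : R) : cosint m 0 = 0.
Proof. by rewrite /cosint mulr0 sin0 mul0r if_same. Qed.

Lemma cosint1 (R : realType) (m : R) :
  sin (m * pi) = 0 -> cosint m 1 = (m == 0)%:R.
Proof. by rewrite /cosint mulr1 => ->; rewrite mul0r; case: eqP. Qed.

(** * Deterministic cosine sums and their Lipschitz constant *)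

(** [rand_f] at a fixed outcome, with the coefficients as an argument so that their signs can be
    changed. *)
Definition cosine_sum {R : realType} (L : seq nat) (c : nat -> R) (x : R) : R :=
  \sum_(k <- L) c k * Num.sqrt 2 * cos (k%:R * pi * x).

Lemma normr_cosB (R : realType) (a b : R) : `|cos a - cos b| <= `|a - b|.
Proof.
wlog ab : a b / a < b.
  move=> h; have [/h//|/h|->] := ltgtP a b; last by rewrite !subrr.
  by rewrite distrC (distrC b).
have [|x _] := MVT ab (fun x _ => is_derive_cos x : is_derive x 1 cos (- sin x)).
  by apply: derivable_within_continuous => x _; exact: derivable_cos.
rewrite (distrC (cos a)) (distrC a) => ->.
by rewrite normrM ler_piMl// normrN sin_max.
Qed.

Section cosine_sum_norms.
Context {R : realType}.
Implicit Types (L : seq nat) (c : nat -> R) (x y : R).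

Lemma normr_le_l2 L c k : k \in L -> `|c k| <= Num.sqrt (\sum_(j <- L) c j ^+ 2).
Proof.
move=> kL; rewrite -sqrtr_sqr ler_wsqrtr// (big_rem k)//= lerDl sumr_ge0//.
by move=> j _; exact: sqr_ge0.
Qed.

(** At most [M] terms, each with coefficient at most the l2 norm and a [K pi]-Lipschitz cosine. This
    is crude, but only a power of [eps] is at stake. *)
Lemma normr_cosine_sumB L c (K M : R) x y :
  (forall k, k \in L -> k%:R <= K) -> (size L)%:R <= M ->
  `|cosine_sum L c x - cosine_sum L c y| <=
    M * (Num.sqrt 2 * (K * pi)) * Num.sqrt (\sum_(k <- L) c k ^+ 2) * `|x - y|.
Proof.
move=> LK LM; rewrite /cosine_sum -sumrB.
apply: le_trans (ler_norm_sum _ _ _) _.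
set B := Num.sqrt (\sum_(k <- L) _).
apply: (@le_trans _ _ (\sum_(k <- L) Num.sqrt 2 * (K * pi) * B * `|x - y|)).
  rewrite big_seq [leRHS]big_seq; apply: ler_sum => k kL.
  rewrite -mulrBr normrM normrM (ger0_norm (sqrtr_ge0 _)).
  rewrite [leRHS](_ : _ = B * Num.sqrt 2 * (K * pi * `|x - y|)); last by ring.
  apply: ler_pM; rewrite ?mulr_ge0//.
    by rewrite ler_wpM2r// normr_le_l2.
  apply: le_trans (normr_cosB _ _ _) _.
  rewrite -mulrBr normrM ler_wpM2r// normrM (ger0_norm (pi_ge0 _)).
  by rewrite ler_wpM2r ?pi_ge0// ger0_norm// LK.
rewrite big_const_seq count_predT iter_addr_0 -[leLHS]mulr_natl -!mulrA.
(* The sign of [K] is known only once some frequency lies below it, so the empty list is treated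
   apart. *)
have [L0|L0] := eqVneq L [::].
  by rewrite /B L0 big_nil /= sqrtr0 mulr0n !(mul0r, mulr0).
have K0 : 0 <= K.
  by case: L L0 LK {LM B} => // k L _ LK; apply: le_trans (LK k _); rewrite ?mem_head.
by rewrite ler_wpM2r// !mulr_ge0// ?pi_ge0 ?sqrtr_ge0.
Qed.

Lemma continuous_cosine_sum L c : continuous (cosine_sum L c).
Proof.
move=> x; apply: differentiable_continuous; apply/derivable1_diffP.
have /@ex_derive// : is_derive x 1 (cosine_sum L c)
    (\sum_(k <- L) (c k * Num.sqrt 2) * (k%:R * pi * - sin (k%:R * pi * x))).
apply: is_derive_sumr => k.
apply: (@is_deriveZ _ _ _ (fun y => cos (k%:R * pi * y)) (c k * Num.sqrt 2)).
by apply: is_derive1_scale; exact: is_derive_cos.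
Qed.

End cosine_sum_norms.

(** * The essential supremum of a continuous function *)

Section uniform_norm.
Context {R : realType} (f : R -> R) (t : R).
Hypothesis f_cont : continuous f.

(** By continuity a violation at one point spreads to a nondegenerate interval, clipped to the unit
    interval. Such an interval contains a rational and has positive measure, which yields the two
    characterisations that follow. *)
Let gt_itv x : x \in `[0, 1] -> t < `|f x| ->
  exists a b : R, [/\ a < b, 0 <= a, b <= 1 &
    forall y, y \in `]a, b[ -> t < `|f y|].
Proof.
rewrite in_itv/= => /andP[x0 x1] tx.
have : (`|f y| @[y --> x] --> `|f x|) by apply: cvg_norm; exact: f_cont.
move=> /cvgrPdist_lt/(_ (`|f x| - t)); rewrite subr_gt0 => /(_ tx).
move=> /nbhs_ballP[e/= e0 xe].
exists (Num.max 0 (x - e)), (Num.min 1 (x + e)); split.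
- by rewrite gt_max !lt_min; apply/andP; split; apply/andP; split; lra.
- by rewrite le_max lexx.
- by rewrite ge_min lexx.
- move=> y; rewrite in_itv/= gt_max lt_min => /andP[/andP[_ yx] /andP[_ xy]].
  have := xe y; rewrite /ball/= ltr_distlC => /(_ _)/ltr_normlW.
  by rewrite xy -ltrBlDr yx/= => /(_ isT); lra.
Qed.

Lemma normr_le_ratP :
  (forall x, x \in `[0, 1] -> `|f x| <= t) <->
  (forall q : rat, (ratr q : R) \in `[0, 1] -> `|f (ratr q)| <= t).
Proof.
split=> [h q|h x x01]; first exact: h.
rewrite leNgt; apply/negP => /(gt_itv _ x01)[a [b [ab a0 b1 h1]]].
have [q qab] := rat_in_itvoo ab.
have := h1 _ qab; apply/negP; rewrite -leNgt h//.
by move: qab; rewrite !in_itv/= => /andP[]; lra.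
Qed.

Lemma Lnormy_leb01P :
  ('N[leb01]_(+oo)[EFin \o f] <= t%:E)%E <->
  (forall x, x \in `[0, 1] -> `|f x| <= t).
Proof.
rewrite unlock /=.
(* The sup norm is defined by cases on whether the whole space has positive measure. *)
have -> : (0 < @leb01 R [set: R])%E.
  rewrite /leb01 /mrestr setTI/= lebesgue_measure_itv/= lte_fin ltr01.
  by rewrite oppr0 adde0 lte_fin ltr01.
split=> [/ess_supP [N [mN N0 Nf]] x x01|h].
  rewrite leNgt; apply/negP => /(gt_itv _ x01)[a [b [ab a0 b1 h1]]].
  have : (lebesgue_measure (`]a, b[%classic : set R) <= 0)%E.
    rewrite -[leRHS]N0 /leb01 /= /mrestr; apply: le_measure; rewrite ?inE//.
      by apply: measurableI => //; exact: measurable_itv.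
    move=> y /= yab; split; last first.
      by move: yab; rewrite !in_itv/= => /andP[]; lra.
    by apply: Nf => /=; rewrite lee_fin leNgt h1.
  rewrite lebesgue_measure_itv/= lte_fin ab -EFinD lee_fin.
  by rewrite leNgt subr_gt0 ab.
apply/ess_supP; exists (~` `[0, 1]); split.
- by apply: measurableC; exact: measurable_itv.
- by rewrite /leb01 /= /mrestr setICl measure0.
- move=> x /= xt x01; apply: xt; rewrite lee_fin; exact: h.
Qed.

End uniform_norm.

(** * Parseval's identity for cosine sums *)

(** Expand the square and use [2 cos a cos b = cos (a - b) + cos (a + b)]; the 2 is [Num.sqrt 2]
    squared. *)
Lemma is_derive_cosine_sumsqr (R : realType) (L : seq nat) (c : nat -> R) (x : R) :
  is_derive x 1
    (fun y => \sum_(k <- L) \sum_(l <- L) c k * c l *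
       (cosint (k%:R - l%:R) y + cosint (k%:R + l%:R) y))
    (cosine_sum L c x ^+ 2).
Proof.
have -> : cosine_sum L c x ^+ 2 = \sum_(k <- L) \sum_(l <- L) c k * c l *
    (cos ((k%:R - l%:R) * pi * x) + cos ((k%:R + l%:R) * pi * x)).
  rewrite /cosine_sum expr2 big_distrlr/=.
  apply: eq_bigr => k _; apply: eq_bigr => l _.
  rewrite !mulrBl !mulrDl cosB cosD.
  transitivity (c k * c l * (Num.sqrt 2 ^+ 2 *
    (cos (k%:R * pi * x) * cos (l%:R * pi * x)))); first by ring.
  by rewrite sqr_sqrtr//; ring.
apply: is_derive_sumr => k; apply: is_derive_sumr => l.
apply: (@is_deriveZ _ _ _
  (cosint (k%:R - l%:R) \+ cosint (k%:R + l%:R)) (c k * c l)).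
by apply: is_deriveD; exact: is_derive_cosint.
Qed.

(** At 1 a primitive [cosint m] with integer [m] survives only for [m = 0]. As [k + l] is never 0 on
    [L], only the differences with [k = l] remain; a zero frequency would be counted twice. *)
Lemma integral_cosine_sumsqr (R : realType) (L : seq nat) (c : nat -> R) :
  uniq L -> 0%N \notin L ->
  (\int[lebesgue_measure]_(x in `[0%R, 1%R]) (cosine_sum L c x ^+ 2)%:E)%E =
  (\sum_(k <- L) c k ^+ 2)%:E.
Proof.
move=> uL L0; pose F y : R := \sum_(k <- L) \sum_(l <- L) c k * c l *
  (cosint (k%:R - l%:R) y + cosint (k%:R + l%:R) y).
have dF (x : R) : is_derive x 1 F (cosine_sum L c x ^+ 2).
  exact: is_derive_cosine_sumsqr.
have cF (x : R) : {for x, continuous F}.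
  apply: differentiable_continuous; apply/derivable1_diffP.
  exact: (@ex_derive _ _ _ _ _ _ _ (dF x)).
rewrite (@continuous_FTC2 _ _ F)//.
- have -> : F 0 = 0.
    rewrite /F big1// => k _; rewrite big1// => l _.
    by rewrite !cosint0 addr0 mulr0.
  rewrite sube0; congr EFin; rewrite /F big_seq [RHS]big_seq.
  apply: eq_bigr => k kL; rewrite (bigD1_seq k)//= big_seq_cond big1 => [|l].
    rewrite subrr !cosint1 ?mul0r ?sin0//; last first.
      by rewrite -natrD sin_natmulpi.
    rewrite eqxx -natrD pnatr_eq0 addn_eq0 andbb.
    have /negbTE-> : k != 0%N by apply: contraNneq L0 => <-.
    by rewrite !addr0 mulr1.
  move=> /andP[lL lk]; rewrite !cosint1; last 2 first.
    by rewrite -natrD sin_natmulpi.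
    by rewrite mulrBl sinB !sin_natmulpi mul0r mulr0 subrr.
  rewrite subr_eq0 eqr_nat eq_sym (negbTE lk) -natrD pnatr_eq0 addn_eq0.
  have /negbTE-> : k != 0%N by apply: contraNneq L0 => <-.
  by rewrite addr0 mulr0.
- apply: continuous_subspaceT => x.
  exact: (continuous_comp (@continuous_cosine_sum R L c x) (@exprn_continuous R 2 _)).
- split=> [x _||]; first exact: (@ex_derive _ _ _ _ _ _ _ (dF x)).
  + by apply: cvg_at_right_filter; exact: cF.
  + by apply: cvg_at_left_filter; exact: cF.
- by move=> x _; rewrite derive1E; exact: derive_val.
Qed.

(** [leb01] is a measure on the whole line for which the complement of the unit interval is null. *)
Lemma ge0_integral_leb01 (R : realType) (f : R -> \bar R) :
  measurable_fun setT f -> (forall x, 0 <= f x)%E ->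
  (\int[leb01]_x f x = \int[lebesgue_measure]_(x in `[0%R, 1%R]) f x)%E.
Proof.
move=> mf f0.
rewrite (@ge0_negligible_integral _ _ _ _ _
  (~` (`[0%R, 1%R]%classic : set (measurableTypeR R))))//; last 2 first.
- by apply: measurableC; exact: measurable_itv.
- by rewrite /leb01 /= /mrestr setICl measure0.
rewrite setDE setCK setTI; apply: eq_measure_integral => A mA A01.
by rewrite /leb01 /= /mrestr setIidl.
Qed.

Lemma Lnorm2_cosine_sum (R : realType) (L : seq nat) (c : nat -> R) :
  uniq L -> 0%N \notin L ->
  ('N[leb01]_(2%:E)[EFin \o cosine_sum L c])%E =
  (Num.sqrt (\sum_(k <- L) c k ^+ 2))%:E.
Proof.
move=> uL L0; rewrite unlock /=.
have E (x : measurableTypeR R) :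
    (`|(EFin \o cosine_sum L c) x| `^ 2%R = (cosine_sum L c x ^+ 2)%:E)%E.
  by rewrite /= powR_mulrn// real_normK ?num_real.
rewrite (eq_integral (fun x : measurableTypeR R =>
  (cosine_sum L c x ^+ 2)%:E)); last first.
  by move=> x _; exact: E.
rewrite ge0_integral_leb01.
- rewrite integral_cosine_sumsqr// poweR_EFin powR12_sqrt//.
  by apply: sumr_ge0 => k _; exact: sqr_ge0.
- apply/measurable_EFinP.
  apply: (@measurable_funX _ _ _ _ (cosine_sum L c) 2).
  by apply: continuous_measurable_fun; exact: continuous_cosine_sum.
- by move=> x; rewrite lee_fin sqr_ge0.
Qed.

(** * Sign invariance of the Gaussian vector *)

(** The density is even and Lebesgue measure is invariant under reflection. *)
Lemma normal_probN (R : realType) (s : R) (B : set R) : s != 0 ->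
  measurable B -> normal_prob 0 s (-%R @^-1` B) = normal_prob 0 s B.
Proof.
move=> s0 mB; rewrite /normal_prob.
pose N : measurableTypeR R -> measurableTypeR R := -%R.
have mN : measurable_fun setT N.
  by apply: continuous_measurable_fun; exact: oppr_continuous.
have pdfN x : normal_pdf 0 s (- x) = normal_pdf 0 s x.
  by rewrite !normal_pdfE// /normal_fun !subr0 sqrrN.
under eq_integral do rewrite -pdfN.
rewrite -(@ge0_integral_pushforward _ _ _ _ _ N mN _ B
  (fun y => (normal_pdf 0 s y)%:E))//.
- by apply: eq_measure_integral => A mA _; exact: lebesgue_measureN.
- by apply/measurable_EFinP; apply: measurable_funTS; exact: measurable_normal_pdf.
- by move=> x _; rewrite lee_fin normal_pdf_ge0.
Qed.

(** An intersection-stable family of boxes whose probabilities independence determines. Only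
    coordinates in [L] are constrained, since nothing is assumed on the other variables. *)
Definition cylinders {R : realType} (L : seq nat) : set (set (nat -> R)) :=
  [set A | exists2 B : nat -> set R, (forall k, measurable (B k)) &
    A = \bigcap_(k in [set k | k \in L]) ((fun y => y k) @^-1` B k)].

Section sign_symmetry.
Context d (T : measurableType d) (R : realType) (P : probability T R).
Variables (L : seq nat) (X : nat -> T -> R).
Hypothesis L_uniq : uniq L.
Hypothesis X_normal : forall k, k \in L -> std_normal P (X k).
Hypothesis X_indep : mutually_independent P L X.

Let vec (s : nat -> bool) (w : T) : g_sigma_algebraType (@cylinders R L) :=
  fun k => (-1) ^+ s k * X k w.

Let flip (s : nat -> bool) (B : nat -> set R) k : set R :=
  (fun x => (-1) ^+ s k * x) @^-1` B k.

Let measurable_flip s B k : measurable (B k) -> measurable (flip s B k).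
Proof.
by move=> mB; rewrite -[flip _ _ _]setTI; exact: measurable_funM.
Qed.

Let vec_cylinder s (B : nat -> set R) :
  vec s @^-1` (\bigcap_(k in [set k | k \in L]) ((fun y => y k) @^-1` B k)) =
  \bigcap_(k in [set k | k \in L]) (X k @^-1` flip s B k).
Proof. by []. Qed.

Let measurable_vec s : measurable_fun setT (vec s).
Proof.
apply: measurability => // _ [_ [B mB ->] <-]; rewrite setTI vec_cylinder.
apply: bigcap_measurableType => k /= kL.
rewrite -[X in measurable X]setTI.
by apply: (X_normal _ kL).1 => //; exact: measurable_flip.
Qed.

Let vec_false (A : set (nat -> R)) :
  vec (fun=> false) @^-1` A = [set w | A (fun k => X k w)].
Proof.
apply/funext => w; congr A; apply/funext => k.
by rewrite /vec expr0 mul1r.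
Qed.

Lemma measurable_cylindrical (A : set (nat -> R)) :
  <<s cylinders L >> A -> measurable [set w | A (fun k => X k w)].
Proof.
by move=> mA; rewrite -vec_false -[X in measurable X]setTI; exact: measurable_vec.
Qed.

(** The laws of the signed and unsigned vectors agree on [cylinders], hence on the generated
    sigma-algebra by uniqueness of measures. *)
Lemma sign_symmetric_law (s : nat -> bool) (A : set (nat -> R)) :
  <<s cylinders L >> A ->
  P [set w | A (fun k => (-1) ^+ s k * X k w)] =
  P [set w | A (fun k => X k w)].
Proof.
move=> mA.
rewrite -vec_false.
pose mvec s' : {mfun T >-> g_sigma_algebraType (@cylinders R L)} :=
  HB.pack (vec s') (isMeasurableFun.Build _ _ _ _ _ (measurable_vec s')).
apply: (g_sigma_algebra_measure_unique (cylinders L : set (set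
  (g_sigma_algebraType (@cylinders R L)))) _ (fun=> setT) _ _
  (pushforward P (mvec s)) (pushforward P (mvec (fun=> false)))) => //.
- exact: sub_sigma_algebra.
- by move=> _; exists (fun=> setT) => //; apply/seteqP.
- by rewrite bigcup_const//; exists 0%N.
- move=> _ _ [B mB ->] [C mC ->]; exists (fun k => B k `&` C k).
    by move=> k; exact: measurableI.
  by rewrite -bigcapI.
- move=> _ [B mB ->].
  (* The right-hand side does not involve [s'], so one computation serves both laws. *)
  have cyl s' : P (vec s' @^-1` (\bigcap_(k in [set k | k \in L])
      ((fun y => y k) @^-1` B k))) = (\prod_(k <- L) normal_prob 0 1 (B k))%E.
    rewrite vec_cylinder X_indep//; last by move=> k _; exact: measurable_flip.
    rewrite big_seq [RHS]big_seq; apply: eq_bigr => k kL.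
    rewrite (X_normal _ kL).2; last exact: (measurable_flip s' B).
    rewrite /flip.
    case: (s' k) => /=; last first.
      by congr normal_prob; apply/funext => x /=; rewrite expr0 mul1r.
    rewrite -(normal_probN _ _ (B k) (oner_neq0 _))//.
    by congr normal_prob; apply/funext => x /=; rewrite expr1 mulN1r.
  by transitivity ((\prod_(k <- L) normal_prob 0 1 (B k))%E); [|symmetry]; exact: cyl.
- by move=> _; change (P setT < +oo)%E; rewrite probability_setT ltry.
Qed.

(* Averaging [P [set w | A (X^~ w)]] over all sign changes turns it into the
   integral over [w] of the fraction of sign patterns sending [X^~ w] into [A]. *)
Lemma sign_symmetrization (I : finType) (e : nat -> I) (A : set (nat -> R)) (beta : R) :
  <<s cylinders L >> A ->
  (forall y : nat -> R,
    #|[pred s : {ffun I -> bool} | `[< A (fun k => (-1) ^+ s (e k) * y k) >]]|%:R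
      <= 2 ^+ #|I| * beta) ->
  (P [set w | A (fun k => X k w)] <= beta%:E)%E.
Proof.
move=> mA bound.
pose As (s : {ffun I -> bool}) := vec (s \o e) @^-1` A.
have mAs s : measurable (As s).
  by rewrite -[As s]setTI; exact: measurable_vec.
rewrite -(@lee_pmul2l _ (2 ^+ #|I|)%:E)// ?lte_fin ?exprn_gt0// -EFinM.
have -> : ((2 ^+ #|I|)%:E * P [set w | A (fun k => X k w)] =
    \sum_(s : {ffun I -> bool}) P (As s))%E.
  under eq_bigr do rewrite (sign_symmetric_law _ _ mA).
  rewrite -natrX mule_natl -card_bool -card_ffun.
  by rewrite big_const /enatmul Monoid.iteropE; congr iter; apply: eq_card.
under eq_bigr => s _ do rewrite -[As s]setIT -(integral_indic _ measurableT)//.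
rewrite -ge0_integral_sum//=; last first.
- by move=> s; apply/measurable_EFinP; exact: measurable_indic.
apply: (@le_trans _ _ (\int[P]_w cst (2 ^+ #|I| * beta)%:E w))%E; last first.
  rewrite integral_cst// [X in (_ * X)%E](_ : _ = 1%E) ?mule1//.
  exact: probability_setT.
apply: ge0_le_integral => //.
- by move=> w _; apply: sume_ge0 => s _; rewrite lee_fin.
- by apply: emeasurable_sum => s; apply/measurable_EFinP; exact: measurable_indic.
move=> w _; rewrite sumEFin lee_fin; apply: le_trans (bound (X^~ w)).
rewrite -sumr_const [leRHS]big_mkcond/=.
apply: ler_sum => s _.
rewrite inE indicE; have [Aw|Aw] := pselect (As s w).
  by rewrite mem_set// asboolT.
by rewrite memNset// asboolF.
Qed.

End sign_symmetry.

(** * Measurability of the good event, and reduction to a grid *)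

Section good_event.
Context {R : realType} (L : seq nat).

Lemma measurable_coord (k : nat) : k \in L ->
  measurable_fun setT (fun y : g_sigma_algebraType (@cylinders R L) => y k : R).
Proof.
move=> kL _ B mB; apply: sub_sigma_algebra.
exists (fun j => if j == k then B else setT); first by move=> j; case: ifP.
rewrite setTI; apply/seteqP; split=> [y yB j _ /=|y /(_ k kL)] /=.
  by case: eqP => [->|].
by rewrite eqxx.
Qed.

Lemma measurable_sum_seq d (T : measurableType d) (h : nat -> T -> R) :
  (forall k, k \in L -> measurable_fun setT (h k)) ->
  measurable_fun setT (fun y => \sum_(k <- L) h k y).
Proof.
move=> mh; under eq_fun do rewrite big_seq big_mkcond/=.
by apply: measurable_sum => k; case: (boolP (k \in L)) => [/mh|_].
Qed.

(* Testing rational points only makes the event visibly measurable. *)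
Definition good (u : R) : set (nat -> R) :=
  [set y | forall q : rat, (ratr q : R) \in `[0, 1] ->
    `|cosine_sum L y (ratr q)| <= u * Num.sqrt (\sum_(k <- L) y k ^+ 2)].

Lemma measurable_good (u : R) : <<s cylinders L >> (good u).
Proof.
suff : measurable (good u : set (g_sigma_algebraType (@cylinders R L))) by [].
(* The complement becomes a countable union over all rationals, those outside the unit interval
   contributing the empty set. *)
rewrite (_ : good u = ~` \bigcup_(q : rat) if (ratr q : R) \in `[0, 1]
    then [set y | u * Num.sqrt (\sum_(k <- L) y k ^+ 2) <
      `|cosine_sum L y (ratr q)|] else set0); last first.
  apply/seteqP; split=> y; rewrite /good /=.
    by move=> h [q _]; case: ifPn => // q01 /=; rewrite ltNge h.
  move=> h q q01; rewrite leNgt; apply/negP => lt; apply: h.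
  by exists q => //; rewrite q01.
apply: measurableC; apply: bigcupT_measurable_rat => q.
case: ifPn => [q01|_]; last exact: measurable0.
pose Y := g_sigma_algebraType (@cylinders R L).
pose f1 (y : Y) := u * Num.sqrt (\sum_(k <- L) (y : nat -> R) k ^+ 2).
pose f2 (y : Y) := `|cosine_sum L (y : nat -> R) (ratr q)|.
have m1 : measurable_fun setT f1.
  apply: measurable_funM => //.
  apply: (@measurableT_comp _ _ _ _ _ _ (@Num.sqrt R)).
    by apply: continuous_measurable_fun; exact: sqrt_continuous.
  apply: measurable_sum_seq => k kL.
  by apply: (measurable_funX 2); exact: measurable_coord.
have m2 : measurable_fun setT f2.
  apply: (@measurableT_comp _ _ _ _ _ _ (@Num.norm R R)) => //.
  apply: measurable_sum_seq => k kL.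
  apply: measurable_funM => //; apply: measurable_funM => //.
  exact: measurable_coord.
have := measurable_fun_ltr m1 m2 measurableT (I : measurable [set true]).
by rewrite setTI.
Qed.

(** Padding with zeros moves the sum to a finite type, where sign patterns can be counted. *)
Lemma sum_seq_ord (m : nat) (F : nat -> R) : uniq L ->
  (forall k, k \in L -> (k <= m)%N) ->
  \sum_(k <- L) F k = \sum_(i < m.+1) if (i : nat) \in L then F i else 0.
Proof.
move=> uL Lm; rewrite -big_mkcond/= -(big_mkord (mem L)) -[RHS]big_filter.
apply: perm_big; apply: uniq_perm => //.
  by rewrite filter_uniq// iota_uniq.
move=> k; rewrite mem_filter mem_index_iota /= ltnS andb_idr//.
exact: Lm.
Qed.

(** Moving to a grid point at distance at most [1 / N] changes [f] by at most [B / 2], which is at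
    most half of [u * B] because [1 <= u]. *)
Lemma grid_gt (f : R -> R) (D u B x : R) (N : nat) :
  (forall x y, `|f x - f y| <= D * B * `|x - y|) -> 0 <= B -> 1 <= u ->
  (0 < N)%N -> D *+ 2 <= N%:R -> 0 <= D ->
  x \in `[0, 1] -> u * B < `|f x| ->
  exists j : 'I_N.+1, u / 2 * B < `|f (j%:R / N%:R)|.
Proof.
move=> fL B0 u1 N0 DN D0; rewrite in_itv/= => /andP[x0 x1] uBx.
have N0' : 0 < N%:R :> R by rewrite ltr0n.
have xN0 : 0 <= x * N%:R by rewrite mulr_ge0.
have /andP[jl ju] := Num.Theory.truncn_itv xN0.
(* The nearest grid point to the left; [x = 1] gives [j = N], hence [N.+1] grid points. *)
set j := Num.trunc (x * N%:R) in jl ju.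
have jN : (j < N.+1)%N.
  rewrite ltnS -(ler_nat R) (le_trans jl)// ler_piMl//.
exists (Ordinal jN) => /=.
have jx : `|x - j%:R / N%:R| <= N%:R^-1.
  rewrite ger0_norm ?subr_ge0 ?ler_pdivrMr//.
  by rewrite lerBlDr -[X in X + _]mul1r -mulrDl nat1r ler_pdivlMr// ltW.
have := fL x (j%:R / N%:R).
have DB : D * B * `|x - j%:R / N%:R| <= B / 2.
  apply: (@le_trans _ _ (D * B * N%:R^-1)).
    by rewrite ler_wpM2l// mulr_ge0.
  rewrite ler_pdivrMr// -mulrA (mulrC D) ler_wpM2l//.
  by rewrite ler_pdivlMl// mulr_natl.
have := ler_normD (f x - f (j%:R / N%:R)) (f (j%:R / N%:R)).
rewrite subrK.
have uB : B <= u * B by rewrite ler_peMl.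
lra.
Qed.

End good_event.

(** * Counting the bad sign patterns by a union bound *)

Lemma card_le_sum (S J : finType) (p : pred S) (Q : J -> pred S) :
  (forall s, p s -> exists j, Q j s) -> (#|p| <= \sum_j #|Q j|)%N.
Proof.
move=> pQ; rewrite -sum1_card big_mkcond/=.
under [leqRHS]eq_bigr do rewrite -sum1_card big_mkcond/=.
rewrite exchange_big/=; apply: leq_sum => s _.
case: ifP => // /pQ[j Qj].
by rewrite (bigD1 j)//= (_ : s \in Q j).
Qed.

(** Sign changes preserve the l2 norm [B], so every bad pattern exceeds [u / 2 * B] at one of the
    [N.+1] grid points, and the tail bound applies at each of them. *)
Lemma card_bad_sign (R : realType) (L : seq nat) (m N : nat) (K M u : R)
    (y : nat -> R) :
  uniq L -> (forall k, k \in L -> (k <= m)%N) ->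
  (forall k, k \in L -> k%:R <= K) -> (size L)%:R <= M ->
  1 <= u -> (0 < N)%N -> 0 <= K -> (M * (Num.sqrt 2 * (K * pi))) *+ 2 <= N%:R ->
  #|[pred s : {ffun 'I_m.+1 -> bool} |
      `[< (~` good L u) (fun k => (-1) ^+ s (inord k) * y k) >]]|%:R <=
  2 ^+ #|'I_m.+1| * (N.+1%:R * (2 * expR (- ((u / 2) ^+ 2 / 16)))).
Proof.
move=> uL Lm LK LM u1 N0 K0 DN.
set B := Num.sqrt (\sum_(k <- L) y k ^+ 2).
have B2 : B ^+ 2 = \sum_(k <- L) y k ^+ 2.
  by rewrite sqr_sqrtr// sumr_ge0// => k _; exact: sqr_ge0.
pose b (j : 'I_N.+1) (i : 'I_m.+1) : R := if (i : nat) \in L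
  then y i * Num.sqrt 2 * cos (i%:R * pi * (j%:R / N%:R)) else 0.
pose Q (j : 'I_N.+1) := [pred s : {ffun 'I_m.+1 -> bool} |
  u / 2 * B < `|\sum_i (-1) ^+ s i * b j i|].
apply: (@le_trans _ _ (\sum_j #|Q j|)%N%:R).
  rewrite ler_nat; apply: card_le_sum => s /= /asboolP.
  set sy := fun k : nat => _.
  have sB : Num.sqrt (\sum_(k <- L) sy k ^+ 2) = B.
    congr Num.sqrt; apply: eq_bigr => k _.
    by rewrite /sy exprMn sqrr_sign mul1r.
  rewrite /good /= => /existsNP[q]; rewrite not_implyP => -[q01 /negP].
  rewrite -ltNge sB => uB.
  have fL x x' := normr_cosine_sumB L sy K M x x' LK LM.
  rewrite sB in fL.
  have M0 : 0 <= M by rewrite (le_trans _ LM).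
  have [||j hj] := @grid_gt R _ _ _ _ _ N fL _ u1 N0 DN _ q01 uB.
  - exact: sqrtr_ge0.
  - by rewrite !mulr_ge0 ?sqrtr_ge0 ?pi_ge0.
  exists j; move: hj; rewrite /Q /= /cosine_sum (sum_seq_ord _ m)//.
  set X := (X in _ < `|X| -> _); set X' := (X in _ -> _ < `|X|).
  suff -> : X = X' by [].
  (* [inord] undoes the inclusion of ['I_m.+1] in [nat], so each frequency of [L] has its own
     sign. *)
  apply: eq_bigr => i _; rewrite /b /sy inord_val; case: ifP => _.
    by rewrite !mulrA.
  by rewrite mulr0.
rewrite natr_sum mulrCA -[N.+1 in leRHS]card_ord -sum1_card natr_sum mulr_suml.
apply: ler_sum => j _; rewrite mul1r.
apply: card_sign_normr_gt.
- by rewrite divr_ge0// (le_trans _ u1).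
- exact: sqrtr_ge0.
rewrite B2 (sum_seq_ord _ m)// mulr_sumr; apply: ler_sum => i _.
rewrite /b; case: ifP => _; last by rewrite expr0n mulr0.
rewrite !exprMn sqr_sqrtr// (mulrC 2).
set x := (X in cos X).
have cos1 : cos x ^+ 2 <= 1.
  by rewrite -real_normK ?num_real// expr_le1// cos_max.
by apply: ler_piMr => //; rewrite mulr_ge0// sqr_ge0.
Qed.

(** * Size of the frequency set, and choice of constants *)

(** Raise [exp (- x / r) <= r / x] to the power [r]; this turns the Gaussian tail into any desired
    power of [eps]. *)
Lemma expRN_le_powR (R : realType) (x r : R) : 0 < x -> 0 < r ->
  expR (- x) <= (r / x) `^ r.
Proof.
move=> x0 r0; rewrite -[in leLHS](divfK (lt0r_neq0 r0) x) -mulNr expRM.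
apply: ge0_ler_powR; rewrite ?nnegrE ?expR_ge0 ?divr_ge0 ?(ltW r0) ?(ltW x0)//.
rewrite expRN -[leRHS]invf_div lef_pV2 ?posrE ?expR_gt0 ?divr_gt0//.
by apply: le_trans (expR_ge1Dx _); rewrite lerDr.
Qed.

Lemma alpha_plus_le1 (R : realType) (gamma : R) : 0 < gamma < 1 ->
  alpha_plus gamma <= 1.
Proof.
move=> /andP[g0 g1]; rewrite -[leRHS]sqrtr1 ler_wsqrtr//.
have p2 := pi_ge2 R.
have s1 : Num.sqrt (1 - gamma) <= 1.
  by rewrite -[leRHS]sqrtr1 ler_wsqrtr// gerBl ltW.
by rewrite ler_pdivrMr; nra.
Qed.

Lemma alpha_minus_gt0 (R : realType) (gamma : R) : 0 < gamma < 1 ->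
  0 < alpha_minus gamma.
Proof.
move=> /andP[g0 g1]; rewrite sqrtr_gt0 divr_gt0//.
  by rewrite subr_gt0 -[ltRHS]sqrtr1 ltr_sqrt// gtrBl.
by rewrite mulr_gt0// exprn_gt0// pi_gt0.
Qed.

Section Lambda_frequencies.
Context {R : realType} (gamma eps : R).
Hypotheses (gamma01 : 0 < gamma < 1) (eps0 : 0 < eps).

Lemma Lambda_uniq : uniq (Lambda gamma eps).
Proof. by rewrite filter_uniq// iota_uniq. Qed.

(** Since [gamma > 0], the lower cutoff [alpha_minus gamma / eps] is positive and so is its ceiling.
    Parseval's identity relies on this. *)
Lemma Lambda_neq0 : 0%N \notin Lambda gamma eps.
Proof.
rewrite mem_filter negb_and negb_and -ltNge ceil_gt0.
by rewrite divr_gt0// alpha_minus_gt0.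
Qed.

Let floor_le_inv : (`|Num.floor (alpha_plus gamma / eps)|%N)%:R <= eps^-1 :> R.
Proof.
have f0 : (0 <= Num.floor (alpha_plus gamma / eps))%R.
  by rewrite floor_ge_int divr_ge0// ?sqrtr_ge0 ?ltW.
rewrite [leLHS]pmulrn gez0_abs//; apply: le_trans (floor_le _) _.
by rewrite -[leRHS]mul1r ler_wpM2r ?invr_ge0 ?(ltW eps0)// alpha_plus_le1.
Qed.

Lemma Lambda_le_floor k : k \in Lambda gamma eps ->
  (k <= `|Num.floor (alpha_plus gamma / eps)|)%N.
Proof. by rewrite mem_filter mem_iota ltnS => /andP[_]. Qed.

Lemma Lambda_le k : k \in Lambda gamma eps -> k%:R <= eps^-1.
Proof.
by move=> /Lambda_le_floor km; rewrite (le_trans _ floor_le_inv)// ler_nat.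
Qed.

Lemma size_Lambda : eps <= 1 -> (size (Lambda gamma eps))%:R <= 2 * eps^-1.
Proof.
move=> eps1; have e1 : 1 <= eps^-1 by rewrite invf_ge1.
apply: (@le_trans _ _ (`|Num.floor (alpha_plus gamma / eps)|%N.+1)%:R).
  by rewrite ler_nat size_filter (leq_trans (count_size _ _))// size_iota.
by rewrite -nat1r mulrDl mul1r lerD// floor_le_inv.
Qed.

End Lambda_frequencies.

Lemma grid_bound (R : realType) (delta q eps : R) :
  0 < delta -> 0 < eps -> eps <= 1 -> 0 < q ->
  exists N : nat, [/\ (0 < N)%N,
    (2 * eps^-1 * (Num.sqrt 2 * (eps^-1 * pi))) *+ 2 <= N%:R &
    N.+1%:R * (2 * expR (- ((eps `^ (- delta) / 2) ^+ 2 / 16))) <=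
      52 * (64 * ((q + 2) / (2 * delta))) `^ ((q + 2) / (2 * delta)) * eps `^ q].
Proof.
(* Twice the Lipschitz factor is [4 * Num.sqrt 2 * pi / eps^2], and [Num.sqrt 2 <= 3 / 2], [pi <= 4]
   give 24. *)
move=> d0 e0 e1 q0; pose N := (Num.trunc (24 / eps ^+ 2)).+1; exists N.
(* Chosen so that [eps^(2 delta)] to the power [r] is [eps^(q + 2)]; the two extra powers pay for
   the grid. *)
pose r := (q + 2) / (2 * delta); rewrite -/r.
have r0 : 0 < r by rewrite divr_gt0 ?mulr_gt0// addr_gt0.
have e20 : 0 < eps ^+ 2 by rewrite exprn_gt0.
have X0 : 0 <= 24 / eps ^+ 2 by rewrite divr_ge0// ltW.
have /andP[Nl Nu] := truncn_itv X0.
have i1 : 1 <= (eps ^+ 2)^-1 by rewrite invf_ge1// expr_le1// ltW.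
split=> //.
  apply: le_trans (ltW Nu); rewrite -mulr_natl.
  rewrite [leLHS](_ : _ = (4 * (Num.sqrt 2 * pi)) / eps ^+ 2); last first.
    by field; rewrite gt_eqF.
  rewrite ler_pM2r ?invr_gt0//.
  have s2 : Num.sqrt 2 <= 3 / 2 :> R.
    rewrite [leRHS](_ : _ = Num.sqrt ((3 / 2) ^+ 2)) ?ler_wsqrtr//; first lra.
    by rewrite sqrtr_sqr ger0_norm.
  have p4 : pi <= 4 :> R by have := pihalf_lt2 R; lra.
  have p0 := pi_ge0 R; have s0 : 0 <= Num.sqrt 2 :> R by exact: sqrtr_ge0.
  by nra.
(* The truncation and the extra grid point cost 2, absorbed since [eps <= 1]. With the two-sided
   tail, 26 becomes the 52 of the bound. *)
have N26 : N.+1%:R <= 26 / eps ^+ 2 :> R.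
  rewrite /N -natr1 -natr1; lra.
pose u := eps `^ (- delta).
have u0 : 0 < u by rewrite powR_gt0.
have u2 : u ^+ 2 = eps `^ (- (2 * delta)).
  by rewrite -powR_mulrn ?powR_ge0// -powRrM mulNr mulrC.
have := @expRN_le_powR R ((u / 2) ^+ 2 / 16) r _ r0.
rewrite divr_gt0 ?exprn_gt0 ?divr_gt0// => /(_ isT) ex.
have E : (r / ((u / 2) ^+ 2 / 16)) `^ r = (64 * r) `^ r * (eps `^ q * eps ^+ 2).
  have -> : r / ((u / 2) ^+ 2 / 16) = 64 * r * eps `^ (2 * delta).
    rewrite -[2 * delta]opprK powRN -u2; field.
    by rewrite gt_eqF.
  rewrite powRM; last 2 first.
  - by rewrite mulr_ge0// ltW.
  - exact: powR_ge0.
  congr (_ * _).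
  rewrite -powRrM /r mulrC divfK ?gt_eqF ?mulr_gt0//.
  rewrite powRD; last by rewrite (gt_eqF e0) implybT.
  by rewrite (powR_mulrn 2 (ltW e0)).
rewrite E in ex.
apply: (@le_trans _ _ (26 / eps ^+ 2 *
    (2 * ((64 * r) `^ r * (eps `^ q * eps ^+ 2))))).
  apply: ler_pM; rewrite ?mulr_ge0 ?expR_ge0//.
  by rewrite ler_pM2l.
rewrite le_eqVlt; apply/orP; left; apply/eqP; field.
by rewrite gt_eqF.
Qed.

(** * The probability estimate *)

Theorem theorem2p6 (R : realType) (gamma delta q : R) :
  0 < gamma < 1 -> 0 < delta -> 1 < q ->
  exists C : R, 0 < C /\
    forall (eps : R), 0 < eps ->
    forall (d : measure_display) (T : measurableType d) (P : probability T R)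
           (c : nat -> T -> R),
      (forall k, k \in Lambda gamma eps -> std_normal P (c k)) ->
      mutually_independent P (Lambda gamma eps) c ->
      (P [set w | ('N[leb01]_(+oo)[EFin \o rand_f gamma eps c w] <=
                  (eps `^ (- delta))%:E * 'N[leb01]_(2%:E)[EFin \o rand_f gamma eps c w])%E]
        >= (1 - C * eps `^ q)%:E)%E.
Proof.
move=> g01 d0 q1; have q0 : 0 < q by rewrite (lt_trans _ q1).
pose r := (q + 2) / (2 * delta).
pose C0 := 52 * (64 * r) `^ r.
have C00 : 0 <= C0 by rewrite mulr_ge0// powR_ge0.
(* [C0] serves [eps <= 1]; the added 1 makes the lower bound nonpositive, hence trivial, when
   [eps > 1]. *)
exists (1 + C0); split; first by rewrite ltr_pwDl.
move=> eps e0 d T P c cN cI.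
set L := Lambda gamma eps; set u := eps `^ (- delta).
have uL : uniq L by exact: Lambda_uniq.
have L0 : 0%N \notin L by exact: Lambda_neq0.
have evE : [set w | ('N[leb01]_(+oo)[EFin \o rand_f gamma eps c w] <=
      u%:E * 'N[leb01]_(2%:E)[EFin \o rand_f gamma eps c w])%E] =
    [set w | good L u (fun k => c k w)].
  apply/funext => w /=; rewrite (Lnorm2_cosine_sum _ L (c^~ w))// -EFinM.
  apply/propext; rewrite Lnormy_leb01P; last exact: continuous_cosine_sum.
  by rewrite normr_le_ratP; last exact: continuous_cosine_sum.
rewrite evE.
have mgood := measurable_good L u.
have [e1|e1] := leP eps 1; last first.
  apply: (@le_trans _ _ 0%E); last exact: measure_ge0.
  rewrite lee_fin subr_le0 mulrDl mul1r.
  have : 1 <= eps `^ q.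
    have := @ge0_ler_powR R q (ltW q0) 1 eps; rewrite !nnegrE powR1.
    by apply=> //; exact: ltW.
  have : 0 <= C0 * eps `^ q by rewrite mulr_ge0// powR_ge0.
  lra.
have u1 : 1 <= u.
  rewrite /u powRN invf_ge1 ?powR_gt0//.
  have := @ge0_ler_powR R delta (ltW d0) eps 1; rewrite !nnegrE powR1.
  by apply=> //; exact: ltW.
have [N [N0 DN bnd]] := grid_bound R delta q eps d0 e0 e1 q0.
have i0 : 0 < eps^-1 by rewrite invr_gt0.
have mbad : <<s cylinders L >> (~` good L u).
  exact: (@measurableC _ (g_sigma_algebraType (cylinders L))).
have mgoodT := @measurable_cylindrical d T R P L c cN _ mgood.
have : (P [set w | (~` good L u) (fun k => c k w)] <=
    (C0 * eps `^ q)%:E)%E.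
  (* The parameters are [K = 1 / eps] for the frequencies, [M = 2 / eps] for their number, and the
     floor of [alpha_plus gamma / eps] as largest index [m]. *)
  have := @sign_symmetrization d T R P L c uL cN cI _ inord _ _ mbad
    (fun y => card_bad_sign R L _ N eps^-1 (2 * eps^-1) u y uL
      (@Lambda_le_floor R gamma eps) (Lambda_le gamma eps g01 e0)
      (size_Lambda gamma eps g01 e0 e1) u1 N0 (ltW i0) DN).
  by move=> /le_trans; apply; rewrite lee_fin.
rewrite (_ : [set w | _] = ~` [set w | good L u (c^~ w)])//.
rewrite probability_setC//.
have := probability_le1 P mgoodT; have := measure_ge0 P [set w | good L u (c^~ w)].
case: (P _) => [p| |]//; rewrite !lee_fin => _ _; rewrite mulrDl mul1r.
have : 0 <= eps `^ q by exact: powR_ge0.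
lra.
Qed.
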